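(* Let $f:X\to\mathbb{R}$ be a tame function, let $f_{\max}=\max_X f$, and for $a\in\mathbb{R}$ let $PH_*(f,a)$ be the persistent homology of $f$ in the range $(-\infty,a]$. Then $$\chi(PH_*(f,f_{\max}))=f_{\max}\,\chi(X)-\int_X f\,\lceil d\chi\rceil,$$ and, in general, for every $a\in\mathbb{R}$, $$\chi(PH_*(f,a))=a\,\chi(X)-\int_X (G_a\circ f)\,\lceil d\chi\rceil,$$ where $G_a(x)=\min(x,a)$.
   Context: Tame functions and the upper Euler integral. $\chi$ is the Euler characteristic (with $\chi(\emptyset)=0$). A continuous function $g:X\to\mathbb{R}$ on a compact topological space $X$ with finite Euler characteristic is tame if the homotopy types of $g^{-1}(-\infty,u]$ and $g^{-1}[u,\infty)$ change only finitely many times as $u$ varies over $\mathbb{R}$ and the Euler characteristic of each of these sets is finite. Write $\chi(g\le u)=\chi(g^{-1}(-\infty,u])$ and define $\chi(g>u):=\chi(X)-\chi(g\le u)$. For tame $g$, the upper Euler integral is $\int_X g\,\lceil d\chi\rceil=\int_0^\infty[\chi(g>u)-\chi(g\le -u)]\,du$. Persistent homology and barcodes. Homology has rational coefficients. The persistent homology $PH_*(f)$ of a tame function $f$ is the persistent homology of the filtration of sublevel sets $\{f^{-1}(-\infty,u]\}_{u\in\mathbb{R}}$. A barcode of it is the collection of bars (intervals from birth time to death time, each with a homology degree) of a basis of persistent homology classes, such that for every time $u$ the classes alive at time $u$ form a basis of $H_*(f^{-1}(-\infty,u])$. $PH_*(f,a)$ denotes the persistent homology restricted to times $u\in(-\infty,a]$,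 i.e. the bars are truncated at time $a$. The Euler characteristic of a barcode $B_*$ with finitely many bars, all of finite length, is $\chi(B_* )=\sum_{b_j\in B_*}(-1)^{\mu(b_j)}\ell(b_j)$, with $\mu(b_j)$ the homology degree and $\ell(b_j)$ the length of $b_j$; equivalently $\chi(B_* )=\int_{\mathbb{R}}\chi_B(u)\,du$, where $\chi_B(u)=\sum_k(-1)^k\#\{\text{bars of degree }k\text{ at time }u\}$. $\chi(PH_*(f,a))$ is the Euler characteristic of its barcode. *)

(* Defs.v *)
From HB Require Import structures.
From mathcomp Require Import all_boot all_order all_algebra.
From mathcomp Require Import all_classical all_reals all_analysis.

Set Implicit Arguments.
Unset Strict Implicit.
Unset Printing Implicit Defensive.

Import Order.TTheory GRing.Theory Num.Theory.
Import numFieldTopology.Exports numFieldNormedType.Exports.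

Local Open Scope classical_set_scope.
Local Open Scope ring_scope.

(** * Singular homology with rational coefficients *)

Definition std_simplex (R : realType) (n : nat) : set 'rV[R]_n.+1 :=
  [set t | (forall i, 0 <= t 0 i) /\ \sum_i t 0 i = 1].
Arguments std_simplex : clear implicits.

Definition face_coord (R : realType) (n : nat) (i : 'I_n.+2) (t : 'rV[R]_n.+1) :
    'rV[R]_n.+2 :=
  \row_j oapp (fun k => t 0 k) 0 (unlift i j).

Lemma face_coord_simplex (R : realType) (n : nat) (i : 'I_n.+2)
    (t : std_simplex R n) :
  std_simplex R n.+1 (face_coord i (val t)).
Proof.
have [/= t_ge0 t_sum] := set_valP t.
split=> [j|]; first by rewrite mxE; case: unliftP => [k|] _ //=.
rewrite (bigD1_ord i) //= mxE unlift_none add0r -[RHS]t_sum.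
by apply: eq_bigr => k _; rewrite mxE liftK.
Qed.

Definition face (R : realType) (n : nat) (i : 'I_n.+2) (t : std_simplex R n) :
    std_simplex R n.+1 :=
  exist _ (face_coord i (val t)) (mem_set (face_coord_simplex i t)).

(* Ambient Q-vector space in which all the singular n-chains of subspaces of X
   live: [c s] is the coefficient of the simplex [s].  Finite support and
   continuity are imposed by [chains] below. *)
Notation chain R X n := ((std_simplex R n -> X) -> rat^o).

Section SingularHomology.
Context {R : realType} {X : topologicalType}.
Implicit Types (A : set X) (n k : nat).

(* A singular simplex of the subspace A is a continuous map into X with image in
   A; hence the chain map induced by an inclusion of subspaces is the identity
   on representatives. *)
Definition chains A n : set (chain R X n) :=
  [set c | finite_set [set s | c s != 0] /\
           forall s, c s != 0 -> continuous s /\ range s `<=` A].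

Definition boundary n (c : chain R X n.+1) : chain R X n :=
  fun t => \sum_(i < n.+2)
    (-1) ^+ i *
      \sum_(s \in [set s : std_simplex R n.+1 -> X | s \o @face R n i = t]) c s.

Definition cycles A n : set (chain R X n) :=
  match n return set (chain R X n) with
  | 0 => @chains A 0
  | m.+1 => [set c | chains A c /\ boundary c = 0]
  end.

(* Equality of the classes of c and d in H_n(A). *)
Definition homologous A n (c d : chain R X n) : Prop :=
  exists2 e, chains A e & c - d = boundary e.

(* The classes of the cycles z i, for i satisfying P, form a basis of the
   rational vector space H_n(A) = cycles / boundaries. *)
Definition homology_basis A n (I : finType) (P : pred I)
    (z : I -> chain R X n) : Prop :=
  [/\ forall i, P i -> cycles A (z i),
      forall q : I -> rat, homologous A (\sum_(i | P i) q i *: z i) 0 ->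
        forall i, P i -> q i = 0
    & forall c, cycles A c ->
        exists q : I -> rat, homologous A c (\sum_(i | P i) q i *: z i)].

Definition has_betti A k (m : nat) : Prop :=
  exists z : 'I_m -> chain R X k, homology_basis A xpredT z.

End SingularHomology.

(* dim H_k(A), with value 0 if H_k(A) is infinite-dimensional. *)
Definition betti (R : realType) (X : topologicalType) (A : set X) (k : nat) :
    nat :=
  xget 0%N [set m | @has_betti R X A k m].
Arguments betti R {X} A k.

Definition finite_euler_char (R : realType) (X : topologicalType) (A : set X) :
    Prop :=
  (forall k, exists m, @has_betti R X A k m) /\
  finite_set [set k | betti R A k != 0%N].
Arguments finite_euler_char R {X} A.

Definition euler_char (R : realType) (X : topologicalType) (A : set X) : int :=
  \sum_(k \in [set: nat]) (-1) ^+ k * (betti R A k)%:Z.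
Arguments euler_char R {X} A.

(** * Tame functions and the upper Euler integral *)

Definition homotopic (R : realType) (Y Z : topologicalType) (g h : Y -> Z) :
    Prop :=
  exists H : R * Y -> Z,
    [/\ {within `[0, 1] `*` [set: Y], continuous H},
        forall y, H (0, y) = g y & forall y, H (1, y) = h y].
Arguments homotopic R {Y Z} g h.

Definition homotopy_equivalent (R : realType) (Y Z : topologicalType) : Prop :=
  exists (g : Y -> Z) (h : Z -> Y),
    [/\ continuous g, continuous h,
        homotopic R (h \o g) idfun & homotopic R (g \o h) idfun].

Definition finitely_many_homotopy_changes (R : realType) (X : topologicalType)
    (F : R -> set X) : Prop :=
  exists2 S : set R, finite_set S &
    forall u v, u <= v -> `[u, v] `&` S = set0 ->
      homotopy_equivalent R (set_type (F u)) (set_type (F v)).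

Section Tame.
Context {R : realType} {X : topologicalType}.
Implicit Type g : X -> R.

Definition sublevel g (u : R) : set X := [set x | g x <= u].
Definition superlevel g (u : R) : set X := [set x | u <= g x].

Record tame g : Prop := Tame {
  tame_compact : compact [set: X];
  tame_finite_euler : finite_euler_char R [set: X];
  tame_continuous : continuous g;
  tame_sublevel : finitely_many_homotopy_changes (sublevel g);
  tame_superlevel : finitely_many_homotopy_changes (superlevel g);
  tame_euler_sublevel : forall u, finite_euler_char R (sublevel g u);
  tame_euler_superlevel : forall u, finite_euler_char R (superlevel g u)
}.

Definition euler_le g (u : R) : int := euler_char R (sublevel g u).

(* By definition chi(X) - chi(g <= u): this need not be the alternating sum of
   the Betti numbers of the set where u < g. *)
Definition euler_gt g (u : R) : int := euler_char R [set: X] - euler_le g u.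

Definition upper_euler_integral g : R :=
  \int[lebesgue_measure]_(u in `[0, +oo[) (euler_gt g u - euler_le g (- u))%:~R.

Definition is_max g (m : R) : Prop := range g m /\ ubound (range g) m.

End Tame.

(** * Barcodes *)

(* The two booleans tell whether the birth and death times belong to the bar. *)
Record bar (R : realType) := Bar {
  bar_degree : nat;
  birth : R;
  death : R;
  birth_closed : bool;
  death_closed : bool
}.

Definition bar_itv (R : realType) (b : bar R) : interval R :=
  Interval (BSide (birth_closed b) (birth b))
           (BSide (~~ death_closed b) (death b)).

Definition barcode_euler_char (R : realType) (B : seq (bar R)) : R :=
  \sum_(b <- B) (-1) ^+ bar_degree b * (death b - birth b).

(* B is a barcode of PH_*(f, a), the persistent homology of the sublevel sets
   of f at the times u <= a.  The cycle [z k j u] represents at time u the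
   persistent class carried by the j-th bar; it is only meaningful if k is the
   degree of this bar and if the bar is alive at time u.  A class that has died
   is zero.  A bar that would survive past a is truncated at a, and as sublevel
   sets of a continuous function on a compact space are empty at small times, no
   bar is born at -oo. *)
Definition is_barcode (R : realType) (X : topologicalType) (f : X -> R) (a : R)
    (B : seq (bar R)) : Prop :=
  let b (j : 'I_(size B)) := tnth (in_tuple B) j in
  (forall j, [set` bar_itv (b j)] !=set0 /\
             [set` bar_itv (b j)] `<=` `]-oo, a]) /\
  exists z : forall k : nat, 'I_(size B) -> R -> chain R X k,
    (forall j u v, u <= v -> v <= a -> u \in bar_itv (b j) ->
       homologous (sublevel f v) (z (bar_degree (b j)) j u)
         (if v \in bar_itv (b j) then z (bar_degree (b j)) j v else 0)) /\
    (forall u k, u <= a ->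
       homology_basis (sublevel f u)
         (fun j => (bar_degree (b j) == k) && (u \in bar_itv (b j)))
         (fun j => z k j u)).

(* Main.v *)
Require Import Defs.
From mathcomp Require Import all_boot all_order all_algebra.
From mathcomp Require Import all_classical all_reals all_analysis.
From mathcomp Require Import measurable_realfun ring lra.

Import Order.TTheory GRing.Theory Num.Theory.

Local Open Scope classical_set_scope.
Local Open Scope ring_scope.

(** The Betti numbers of a sublevel set at a time u <= a count the bars alive at
    u, because any two finite bases of rational homology have the same size.
    Hence chi(f <= u) is the alternating sum over the bars of the indicators of
    [u in b].  With g = min(f, a), the sublevel set of g at u is that of f if
    u < a and all of X otherwise, so the integrand chi(g > u) - chi(g <= -u)
    becomes

      chi(X) (1[u < a] - 1[a <= -u])
        - sum_b (-1)^mu(b) (1[u in b, u < a] + 1[-u in b, -u < a]).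

    Over [0, +oo[ the first term integrates to a chi(X); the bracket of a bar
    folds the real line at 0 and so integrates to the length of the bar. *)

(** * Linear algebra of rational singular chains and Betti numbers *)

Lemma fsum_linear (K : pzRingType) (T : choiceType) (A : set T) (a : K)
    (c d : T -> K) :
  finite_set [set x | c x != 0] -> finite_set [set x | d x != 0] ->
  \sum_(x \in A) (a * c x + d x) =
    a * \sum_(x \in A) c x + \sum_(x \in A) d x.
Proof.
move=> cfin dfin.
(* All three summands vanish outside [supp], so one duplicate-free list [r] computes all three sums.
   Finiteness matters: a sum with infinite support defaults to 0, which would break linearity. *)
pose supp := [set x | c x != 0] `|` [set x | d x != 0].
pose r := [seq x <- finmap.enum_fset (fset_set supp) | x \in A].
have supp_fin : finite_set supp by rewrite finite_setU.
have r_uniq : uniq r by rewrite filter_uniq.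
have r_sub : [set` r] `<=` A.
  by move=> x; rewrite /= mem_filter => /andP[/set_mem].
have r_supp x : A x -> x \notin r -> c x = 0 /\ d x = 0.
  rewrite mem_filter in_fset_set// in_setU => Ax.
  rewrite (mem_set Ax) /= negb_or => /andP[].
  by rewrite !notin_setE /= => /negP/negPn/eqP -> /negP/negPn/eqP ->.
rewrite !(fsbigE r)//.
- rewrite big_split /= mulr_sumr; congr (_ + _).
- by move=> x Ax /(r_supp _ Ax)[].
- by move=> x Ax /(r_supp _ Ax)[].
- by move=> x Ax /(r_supp _ Ax)[-> ->]; rewrite mulr0 addr0.
Qed.

Section Homology.
Context {R : realType} {X : topologicalType}.
Implicit Types (A : set X) (n k m : nat).

Lemma chains_linear A n (a : rat) (c d : chain R X n) :
  chains A c -> chains A d -> chains A (a *: c + d).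
Proof.
move=> [cfin cA] [dfin dA].
have supp s : (a *: c + d) s != 0 -> c s != 0 \/ d s != 0.
  have -> : (a *: c + d) s = a * c s + d s by [].
  have [->|] := eqVneq (c s) 0; last by left.
  by rewrite mulr0 add0r; right.
split; last by move=> s /supp[/cA|/dA].
apply: (@sub_finite_set _ _ ([set s | c s != 0] `|` [set s | d s != 0])).
  by move=> s /supp.
by rewrite finite_setU.
Qed.

Lemma chains0 A n : chains A (0 : chain R X n).
Proof.
split; last by move=> s; rewrite eqxx.
rewrite (_ : [set s | _] = set0)//.
by apply/seteqP; split=> // s /=; rewrite eqxx.
Qed.

Lemma boundary_linear A n (a : rat) (c d : chain R X n.+1) :
  chains A c -> chains A d ->
  boundary (a *: c + d) = a *: boundary c + boundary d.
Proof.
move=> [cfin _] [dfin _]; apply/funext => t.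
transitivity (a * boundary c t + boundary d t); last by [].
rewrite /boundary mulr_sumr -big_split /=; apply: eq_bigr => i _.
by rewrite mulrCA -mulrDr -fsum_linear.
Qed.

(** Lets a linear relation between coefficients be carried through expansions that hold only modulo
    boundaries. *)
Lemma homologous_sum A n (I : finType) (P : pred I) (w : I -> rat)
    (c d : I -> chain R X n) :
  (forall i, P i -> homologous A (c i) (d i)) ->
  homologous A (\sum_(i | P i) w i *: c i) (\sum_(i | P i) w i *: d i).
Proof.
move=> cd; rewrite /homologous -sumrB.
elim/big_rec: _ => [|i x Pi [e Ae ->]].
  exists 0; first exact: chains0.
  (* The empty sum needs [boundary 0 = 0], which is linearity with scalar -1 and both chains
     zero. *)
  have := boundary_linear A n (-1) 0 0 (chains0 _ _) (chains0 _ _).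
  by rewrite scaleN1r subrr scaleN1r addNr.
have [e' Ae' dc] := cd i Pi.
exists (w i *: e' + e); first exact: chains_linear.
by rewrite (boundary_linear A)// -scalerBr dc.
Qed.

Lemma homology_basis_betti {A k} {I : finType} {P : pred I}
    {z : I -> chain R X k} :
  homology_basis A P z -> @has_betti R X A k #|P|.
Proof.
move=> [zP zfree zspan]; exists (fun i => z (enum_val i)); split.
- by move=> i _; apply: zP; exact: enum_valP i.
- move=> q q0 i _.
  pose x0 := enum_val i.
  have Px0 : x0 \in P := enum_valP i.
  (* Coefficients indexed by ordinals are carried to [I]; the default that [q'] takes outside [P] is
     harmless, since the sum runs over [P] only. *)
  pose q' x := q (enum_rank_in Px0 x).
  have := zfree q'; rewrite [X in homologous _ X](_ : _ =
      \sum_(i < #|P|) q i *: z (enum_val i)); last first.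
    rewrite (big_enum_val (fun x => q' x *: z x)) /=; apply: eq_bigr => j _.
    by rewrite /q' enum_valK_in.
  by move=> /(_ q0 x0 Px0); rewrite /q' enum_valK_in.
- move=> c /zspan[q cq]; exists (fun i => q (enum_val i)).
  by rewrite -(big_enum_val (fun x => q x *: z x)).
Qed.

(** Expanding the free family [z'] in the spanning family [z] modulo boundaries gives an m' by m
    matrix [N]. A row vector killed by [N] yields a combination of the [z'] that is homologous to 0,
    hence is zero by freeness. So [N] has full row rank, and m' is at most m. *)
Lemma has_betti_le A k m m' :
  @has_betti R X A k m -> @has_betti R X A k m' -> (m' <= m)%N.
Proof.
move=> [z [_ _ zspan]] [z' [z'A z'free _]].
have [M z'M] := choice (fun j => zspan (z' j) (z'A j isT)).
pose N := \matrix_(j, i) M j i.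
rewrite -[m'](_ : \rank N = m') ?rank_leq_col//.
apply/eqP; rewrite -/(row_free N) -kermx_eq0.
apply/eqP/matrixP => r j; rewrite [RHS]mxE.
apply: (z'free (kermx N r)) => //.
have := homologous_sum A k _ xpredT (kermx N r) _ _ (fun j _ => z'M j).
rewrite [X in homologous _ _ X](_ : _ = 0)//.
under eq_bigr do rewrite scaler_sumr; rewrite exchange_big big1//= => i _.
under eq_bigr do rewrite scalerA; rewrite -scaler_suml.
have /matrixP/(_ r i) := mulmx_ker N.
rewrite [RHS]mxE mxE => kN0.
rewrite [X in X *: _](_ : _ = 0) ?scale0r//.
rewrite -[RHS]kN0; apply: (@eq_bigr rat) => l _.
by rewrite [N _ _]mxE.
Qed.

Lemma betti_eq A k m : @has_betti R X A k m -> betti R A k = m.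
Proof.
move=> Am; rewrite /betti; case: xgetP => [_ -> Am'|/(_ m)//].
by apply/eqP; rewrite eqn_leq !(has_betti_le A k).
Qed.

End Homology.

(** * Euler characteristics of sublevel sets read off a barcode *)

Lemma euler_le_barcode {R : realType} {X : topologicalType} {f : X -> R} {a : R}
    {B : seq (bar R)} {u : R} :
  is_barcode f a B -> u <= a ->
  euler_le f u =
    \sum_(b <- B) (-1) ^+ bar_degree b * (u \in bar_itv b)%:R.
Proof.
move=> [_ [z [_ zbasis]]] ua.
pose b := tnth (in_tuple B).
pose alive k j := (bar_degree (b j) == k) && (u \in bar_itv (b j)).
have betti_alive k : betti R (sublevel f u) k = (\sum_j alive k j)%N.
  rewrite (betti_eq _ _ _ (homology_basis_betti (zbasis u k ua))).
  rewrite -sum1_card big_mkcond /=; apply: eq_bigr => j _.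
  by rewrite unfold_in /alive; case: ifP.
(* Betti numbers vanish in degrees carried by no bar, so the sum over all degrees reduces to the
   finite list [r]. *)
pose r := undup (codom (fun j => bar_degree (b j))).
have r_deg j : bar_degree (b j) \in r.
  by rewrite mem_undup (codom_f (fun j => bar_degree (b j))).
rewrite /euler_le /euler_char (fsbigE r) ?undup_uniq//; last first.
  move=> k _ kr; rewrite betti_alive big1 ?mulr0// => j _.
  by rewrite /alive; case: eqP => // jk; rewrite -jk r_deg in kr.
rewrite (eq_bigl xpredT); last by move=> k; rewrite mem_set.
under eq_bigr => k _ do rewrite betti_alive -natz natr_sum mulr_sumr.
rewrite exchange_big /= [RHS]big_tnth; apply: eq_bigr => j _.
rewrite (bigD1_seq (bar_degree (b j))) ?undup_uniq//=.
rewrite big1 ?addr0 => [|k kj]; first by rewrite /alive eqxx.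
by rewrite /alive eq_sym (negbTE kj) mulr0.
Qed.

(** The cut is strict: at [u = a] the truncated function already has all of X as sublevel set, so a
    bar containing [a] must not be counted there. *)
Lemma euler_le_min {R : realType} {X : topologicalType} {f : X -> R} {a : R}
    {B : seq (bar R)} (u : R) :
  is_barcode f a B ->
  (euler_le ((fun x : R => Num.min x a) \o f) u)%:~R =
    (euler_char R [set: X])%:~R * (a <= u)%R%:R +
    \sum_(b <- B)
      (-1) ^+ bar_degree b * ((u < a)%R && (u \in bar_itv b))%:R :> R.
Proof.
move=> Bf; have [ua|au] := ltP u a; last first.
  rewrite big1 ?addr0 ?mulr1 => [|b _]; last by rewrite mulr0.
  rewrite /euler_le (_ : sublevel _ u = setT)//; apply/seteqP; split=> // x _.
  by rewrite /sublevel /= ge_min au orbT.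
rewrite mulr0 add0r /euler_le (_ : sublevel _ u = sublevel f u); last first.
  apply/seteqP; split=> x; rewrite /sublevel /= ge_min.
    by rewrite (leNgt a u) ua orbF.
  by move=> ->.
rewrite -/(euler_le f u) (euler_le_barcode Bf (ltW ua)) rmorph_sum /=.
by apply: eq_bigr => b _; rewrite rmorphM /= rmorph_sign rmorph_nat.
Qed.

(** * Integrals of indicators of intervals over the half-line *)

Section Integration.
Context {R : realType}.
Local Notation mu := (@lebesgue_measure R).

(** Endpoints are null, so it is irrelevant whether a bar contains its birth and death times. The
    maximum with 0 covers [y < x], where [S] is empty. *)
Lemma lebesgue_measure_between (S : set R) (x y : R) :
  measurable S -> `]x, y[ `<=` S -> S `<=` `[x, y] ->
  mu S = (Num.max 0 (y - x))%:E.
Proof.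
move=> mS subS Ssub; apply/eqP; rewrite eq_le; apply/andP; split.
  have -> : (Num.max 0 (y - x))%:E = mu `[x, y].
    rewrite lebesgue_measure_itv /= lte_fin -subr_gt0.
    by case: ltP => // _; rewrite -EFinD.
  by apply: le_measure => //; rewrite inE.
have -> : (Num.max 0 (y - x))%:E = mu `]x, y[.
  rewrite lebesgue_measure_itv /= lte_fin -subr_gt0.
  by case: ltP => // _; rewrite -EFinD.
by apply: le_measure => //; rewrite inE.
Qed.

Lemma integrable_EFin_sum d (T : measurableType d)
    (nu : {measure set T -> \bar R}) (D : set T) (I : Type) (s : seq I)
    (h : I -> T -> R) :
  measurable D -> (forall i, nu.-integrable D (EFin \o h i)) ->
  nu.-integrable D (EFin \o (fun x => \sum_(i <- s) h i x)).
Proof.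
move=> mD hint; rewrite (_ : _ \o _ = (fun x => \sum_(i <- s) (h i x)%:E)%E).
  exact: (@integrable_sum _ _ _ nu D mD _ s xpredT (fun i => EFin \o h i)).
by apply/funext => x; rewrite /= sumEFin.
Qed.

Lemma Rintegral_sum d (T : measurableType d) (nu : {measure set T -> \bar R})
    (D : set T) (I : Type) (s : seq I) (h : I -> T -> R) :
  measurable D -> (forall i, nu.-integrable D (EFin \o h i)) ->
  \int[nu]_(x in D) (\sum_(i <- s) h i x) =
    \sum_(i <- s) \int[nu]_(x in D) h i x.
Proof.
move=> mD hint; elim: s => [|i s IH].
  under eq_Rintegral do rewrite big_nil.
  by rewrite Rintegral_cst// mul0r big_nil.
under eq_Rintegral do rewrite big_cons.
by rewrite RintegralD ?IH ?big_cons//; exact: integrable_EFin_sum.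
Qed.

Lemma Rintegral_indic_between (D S : set R) (x y : R) :
  measurable D -> measurable S ->
  `]x, y[ `<=` S `&` D -> S `&` D `<=` `[x, y] ->
  mu.-integrable D (EFin \o \1_S) /\
  \int[mu]_(u in D) \1_S u = Num.max 0 (y - x).
Proof.
move=> mD mS subS Ssub.
have muSD : mu (S `&` D) = (Num.max 0 (y - x))%:E.
  by apply: lebesgue_measure_between => //; exact: measurableI.
split; last by rewrite /Rintegral integral_indic// [X in fine X]muSD.
apply/integrableP; split.
  by apply/measurable_EFinP; exact: measurable_indic.
under eq_integral => u _ do rewrite /= ger0_norm//.
by rewrite integral_indic// [X in (X < _)%E]muSD ltry.
Qed.

Local Notation D := (`[0%R, +oo[%classic : set R).

(** The part of [S] right of 0 runs from max(x, 0) to y; the part left of 0, reflected, runs from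
    max(-y, 0) to -x. The two lengths add up to y - x wherever 0 lies. *)
Lemma Rintegral_indic_reflect (S : set R) (x y : R) :
  x <= y -> measurable S -> `]x, y[ `<=` S -> S `<=` `[x, y] ->
  mu.-integrable D (EFin \o (fun u => \1_S u + \1_S (- u))) /\
  \int[mu]_(u in D) (\1_S u + \1_S (- u)) = y - x.
Proof.
move=> xy mS subS Ssub.
have mNS : measurable (-%R @^-1` S).
  by rewrite -[X in measurable X]setTI; exact: oppr_measurable.
have [|||intS eqS] := @Rintegral_indic_between D S (Num.max x 0) y _ mS.
- by [].
- move=> u /=; rewrite in_itv /= gt_max => /andP[/andP[xu u0] uy].
  split; first by apply: subS; rewrite /= in_itv /= xu.
  by rewrite /= in_itv /= andbT ltW.
- move=> u [/Ssub /=]; rewrite !in_itv /= ge_max andbT => /andP[-> ->] ->.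
  by [].
have [|||intNS eqNS] :=
  @Rintegral_indic_between D (-%R @^-1` S) (Num.max (- y) 0) (- x) _ mNS.
- by [].
- move=> u /=; rewrite in_itv /= gt_max => /andP[/andP[yu u0] ux].
  split; first by apply: subS; rewrite /= in_itv /=; apply/andP; lra.
  by rewrite /= in_itv /= andbT ltW.
- move=> u [/Ssub /=]; rewrite !in_itv /= ge_max andbT => /andP[xu uy] ->.
  by rewrite andbT; apply/andP; lra.
split; first exact: (integrableD _ intS intNS).
rewrite [LHS](RintegralD _ intS intNS)// eqS eqNS.
have [?|?] := ltP x 0; have [?|?] := ltP (- y) 0;
  case: (ltP 0 (y - _)) => ?; case: (ltP 0 (- x - _)) => ?; lra.
Qed.

(** The two indicators contribute max(0, a) and max(0, -a), whose difference is a for either sign of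
    a. *)
Lemma Rintegral_indic_ray (a : R) :
  mu.-integrable D (EFin \o (fun u => (u < a)%R%:R - (a <= - u)%R%:R)) /\
  \int[mu]_(u in D) ((u < a)%R%:R - (a <= - u)%R%:R) = a.
Proof.
have [||||inta eqa] := @Rintegral_indic_between D `]-oo, a[ 0 a.
- by [].
- by [].
- by move=> u /=; rewrite !in_itv /= andbT => /andP[/ltW -> ->].
- by move=> u [] /=; rewrite !in_itv /= andbT => /ltW -> ->.
have [||||intNa eqNa] := @Rintegral_indic_between D `]-oo, (- a)] 0 (- a).
- by [].
- by [].
- by move=> u /=; rewrite !in_itv /= andbT => /andP[/ltW -> /ltW ->].
- by move=> u [] /=; rewrite !in_itv /= andbT => -> ->.
have -> : (fun u => (u < a)%R%:R - (a <= - u)%R%:R) =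
    (\1_`]-oo, a[ \- \1_`]-oo, (- a)] : R -> R).
  by apply/funext => u; rewrite /= !indicE !mem_setE !in_itv /= lerNr.
split; first exact: (integrableB _ inta intNa).
rewrite [LHS](RintegralB _ inta intNa)// eqa eqNa.
by have [?|?] := ltP 0 (a - 0); have [?|?] := ltP 0 (- a - 0); lra.
Qed.

End Integration.

(** * The upper Euler integral of the truncated function *)

Lemma upper_euler_integral_min {R : realType} {X : topologicalType}
    {f : X -> R} {a : R} {B : seq (bar R)} :
  is_barcode f a B ->
  upper_euler_integral ((fun x : R => Num.min x a) \o f) =
    a * (euler_char R [set: X])%:~R - barcode_euler_char B.
Proof.
move=> Bf; have [bar_le _] := Bf.
pose chi : R := (euler_char R [set: X])%:~R.
pose b := tnth (in_tuple B).
(* Intersecting with [u < a] removes at most the point [a] from a bar, as [da] below shows, so the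
   length is unchanged. *)
pose S j : set R := `]-oo, a[ `&` [set` bar_itv (b j)].
have S_int j := @Rintegral_indic_reflect R (S j) (birth (b j)) (death (b j)).
have {}S_int j : lebesgue_measure.-integrable `[0, +oo[
      (EFin \o (fun u => \1_(S j) u + \1_(S j) (- u))) /\
    \int[lebesgue_measure]_(u in `[0, +oo[) (\1_(S j) u + \1_(S j) (- u)) =
      death (b j) - birth (b j).
  have [[v bar_v] bar_sub] := bar_le j.
  have [bv vd] : birth (b j) <= v /\ v <= death (b j).
    by move: bar_v; rewrite /= in_itv /= => /andP[/lteifW -> /lteifW ->].
  have va : v <= a by have := bar_sub _ bar_v; rewrite /= in_itv.
  have bd : birth (b j) <= death (b j) by exact: le_trans vd.
  have da : death (b j) <= a.
    rewrite leNgt; apply/negP => ad.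
    (* A bar dying after [a] would contain the midpoint of [a] and its death, which lies beyond
       [a]. *)
    have /bar_sub : [set` bar_itv (b j)] ((a + death (b j)) / 2).
      by rewrite /= in_itv /=; apply/andP; split; apply: lteifS; lra.
    by rewrite /= in_itv /= => ?; lra.
  apply: S_int => //.
  - by apply: measurableI; exact: measurable_itv.
  - move=> u /=; rewrite in_itv /= => /andP[bu ud].
    split; rewrite /= in_itv /=; first exact: lt_le_trans da.
    by rewrite !lteifS.
  - move=> u [_]; rewrite /= !in_itv /=.
    by move=> /andP[/lteifW -> /lteifW ->].
have [ray_int ray_eq] := Rintegral_indic_ray a.
pose h j u : R := (-1) ^+ bar_degree (b j) * (\1_(S j) u + \1_(S j) (- u)).
have h_int j : lebesgue_measure.-integrable `[0, +oo[ (EFin \o h j).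
  have [S_j _] := S_int j; exact: (integrableZl _ _ S_j).
have -> : upper_euler_integral ((fun x : R => Num.min x a) \o f) =
    \int[lebesgue_measure]_(u in `[0, +oo[)
      (chi * ((u < a)%R%:R - (a <= - u)%R%:R) - \sum_j h j u).
  apply: eq_Rintegral => u _; rewrite /euler_gt !rmorphB /= -/chi.
  move: (fun v => euler_le_min v Bf).
  move: (euler_le _) => chi_le chi_leE; rewrite !chi_leE -/chi.
  have indic_S j v : \1_(S j) v = ((v < a)%R && (v \in bar_itv (b j)))%:R.
    by rewrite indicE in_setI !mem_setE in_itv.
  under [in RHS]eq_bigr => j _ do rewrite /h !indic_S mulrDr.
  rewrite big_split /= !(big_tnth _ _ B) /= -/b.
  (* In chi(g > u) the whole-space term is chi(X) minus chi(X) times 1[a <= u]; this complement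
     merges it into 1[u < a]. *)
  have -> : (u < a)%R%:R = 1 - (a <= u)%R%:R :> R.
    by rewrite ltNge; case: (a <= u); rewrite ?subrr ?subr0.
  set s := \sum_(i < _) _; set s' := \sum_(i < _) _.
  by move: s s' (_%:R) (_%:R) => s s' p q; ring.
rewrite RintegralB//.
- rewrite RintegralZl// ray_eq mulrC; congr (_ - _).
  rewrite Rintegral_sum// /barcode_euler_char [RHS]big_tnth.
  apply: eq_bigr => j _.
  have [? <-] := S_int j; exact: RintegralZl.
- exact: (integrableZl _ _ ray_int).
- exact: integrable_EFin_sum.
Qed.

Theorem proposition6p2 (R : realType) (X : topologicalType) (f : X -> R)
    (f_tame : tame f) :
  (forall (fmax : R) (B : seq (bar R)),
     is_max f fmax -> is_barcode f fmax B ->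
     barcode_euler_char B =
       fmax * (euler_char R [set: X])%:~R - upper_euler_integral f) /\
  (forall (a : R) (B : seq (bar R)),
     is_barcode f a B ->
     barcode_euler_char B =
       a * (euler_char R [set: X])%:~R
         - upper_euler_integral ((fun x : R => Num.min x a) \o f)).
Proof.
have general a B : is_barcode f a B -> barcode_euler_char B =
    a * (euler_char R [set: X])%:~R
      - upper_euler_integral ((fun x : R => Num.min x a) \o f).
  by move=> /upper_euler_integral_min ->; rewrite subKr.
(* The first formula is the general one at [a = fmax], where truncation leaves [f] unchanged. *)
split=> // fmax B [_ f_le] /general ->; congr (_ - upper_euler_integral _).
by apply/funext => x; apply/min_idPl/f_le; exists x.
Qed.
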